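(* Let the system, constraints, cost, horizon $N\ge 1$ and functions $\rho$, $V_f$, $\lambda$ be as in the context, and suppose: (A1) the parameter set $\Theta$ is compact; (A2) the storage function $\lambda(\theta,x)$ is continuous on $\Theta\times\mathbb{X}$; (A3) there exist a compact terminal region $\mathbb{X}_f\subseteq\mathbb{X}$ with $x^s$ as an interior point, a terminal policy $\kappa_f:\mathbb{X}\to\mathbb{U}$ with $\kappa_f(x^s)=u^s$, and a continuous terminal penalty $V_f:\mathbb{X}_f\to\mathbb{R}$ (these $\mathbb{X}_f$ and $V_f$ are the ones used in the optimisation problem), such that for all $x\in\mathbb{X}_f$: (i) $(x,\kappa_f(x))\in\mathbb{Z}$; (ii) $f(x,\kappa_f(x))\in\mathbb{X}_f$; (A4) for all $x\in\mathbb{X}_f$ and all $\theta\in\Theta$ there exists $\theta^+\in\Theta$ such that $$\lambda(\theta^+,f(x,\kappa_f(x)))-\lambda(\theta,x)\le \ell(x,\kappa_f(x))-\ell(x^s,u^s)-\rho(x-x^s).$$ Then for any initial state and storage function parameter $(x_0,\theta_0)\in\mathcal{X}_N$, the economic MPC optimisation problem is recursively feasible: along the closed loop started at $(x_0,\theta_0)$, the optimisation problem $\mathcal{P}_N(x_t,\theta_t)$ is feasible, i.e. $(x_t,\theta_t)\in\mathcal{X}_N$, for every integer $t\ge 0$.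
   Context: System: $x_{t+1}=f(x_t,u_t)$ with state $x\in\mathbb{X}\subseteq\mathbb{R}^n$, input $u\in\mathbb{U}\subseteq\mathbb{R}^m$, and continuous $f:\mathbb{X}\times\mathbb{U}\to\mathbb{X}$. Constraints: $(x_t,u_t)\in\mathbb{Z}$ for all $t\ge0$, where $\mathbb{Z}\subseteq\mathbb{X}\times\mathbb{U}$ is compact. The stage cost $\ell:\mathbb{Z}\to\mathbb{R}$ is continuous. The optimal steady state is $(x^s,u^s)=\arg\min\{\ell(x,u)\mid (x,u)\in\mathbb{Z},\ x=f(x,u)\}$, assumed to exist and be unique. $\Theta$ is a set of (finite-dimensional real) parameters and $\lambda:\Theta\times\mathbb{X}\to\mathbb{R}$ is a parameter-varying storage function. $\rho:\mathbb{R}^n\to\mathbb{R}_{\ge0}$ is a fixed positive definite function: continuous, $\rho(0)=0$, $\rho(z)>0$ for $z\ne0$. EMPC optimisation problem $\mathcal{P}_N(x_t,\theta_t)$ at time $t$, with horizon $N\in\mathbb{Z}_{\ge1}$ (here $\mathbb{Z}_{\geq 1}$ denotes the positive integers): minimise $$J_N=\sum_{k=t}^{t+N-1}\ell(x_{k|t},u_{k|t})+V_f(x_{t+N|t})$$ over sequences $(\theta_{k|t})_{k=t}^{t+N}$, $(x_{k|t})_{k=t}^{t+N}$, $(u_{k|t})_{k=t}^{t+N-1}$ subject to: $x_{t|t}=x_t$; $\theta_{t|t}=\theta_t$; for all $k=t,\dots,t+N-1$: $x_{k+1|t}=f(x_{k|t},u_{k|t})$, $(x_{k|t},u_{k|t})\in\mathbb{Z}$,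 and $$\lambda(\theta_{k+1|t},x_{k+1|t})-\lambda(\theta_{k|t},x_{k|t})+\rho(x_{k|t}-x^s)\le\ell(x_{k|t},u_{k|t})-\ell(x^s,u^s);$$ $\theta_{k|t}\in\Theta$ for $k=t,\dots,t+N$; and $x_{t+N|t}\in\mathbb{X}_f$. $\mathcal{X}_N$ is the set of $(x,\theta)\in\mathbb{X}\times\Theta$ for which $\mathcal{P}_N(x,\theta)$ has a feasible solution. Closed loop: at each time $t$ an optimal solution (marked by $*$) of $\mathcal{P}_N(x_t,\theta_t)$ is computed, and $x_{t+1}=f(x_t,u^*_{t|t})$, $\theta_{t+1}=\theta^*_{t+1|t}$. *)

(* Defs.v *)
From HB Require Import structures.
From mathcomp Require Import all_boot all_order all_algebra.
From mathcomp Require Import all_classical all_reals all_analysis.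
Set Implicit Arguments.
Unset Strict Implicit.
Unset Printing Implicit Defensive.
Import Order.TTheory GRing.Theory Num.Theory.
Import numFieldNormedType.Exports.
Local Open Scope classical_set_scope.
Local Open Scope ring_scope.

(* Functions whose mathematical domain is a subset of R^n are total here; their
   values outside that domain are never used, and their continuity is that of
   the restriction to the domain, {within D, continuous _}. *)

Definition argmin {R : realType} {T : Type} (c : T -> R) (S : set T) : set T :=
  [set s | S s /\ forall s', S s' -> c s <= c s'].

Definition steady_states {R : realType} {n m : nat}
    (f : 'rV[R]_n * 'rV[R]_m -> 'rV[R]_n) (Z : set ('rV[R]_n * 'rV[R]_m)) :
    set ('rV[R]_n * 'rV[R]_m) :=
  [set z | Z z /\ z.1 = f z].

Definition positive_definite {R : realType} {n : nat} (rho : 'rV[R]_n -> R) :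
    Prop :=
  [/\ continuous rho, rho 0 = 0 & forall z, z != 0 -> 0 < rho z].

(* Decision variables of the optimisation problem.  As the problem is time
   invariant, they are indexed by the prediction step k - t instead of by the
   time k.  For horizon N only the parameters and states of index 0, ..., N and
   the inputs of index 0, ..., N-1 matter. *)
Record plan (R : realType) (n m p : nat) := Plan {
  plan_param : nat -> 'rV[R]_p;
  plan_state : nat -> 'rV[R]_n;
  plan_input : nat -> 'rV[R]_m }.

(* (xs, us) is the optimal steady state. *)
Definition feasible {R : realType} {n m p : nat}
    (f : 'rV[R]_n * 'rV[R]_m -> 'rV[R]_n) (Z : set ('rV[R]_n * 'rV[R]_m))
    (ell : 'rV[R]_n * 'rV[R]_m -> R) (xs : 'rV[R]_n) (us : 'rV[R]_m)
    (Theta : set 'rV[R]_p) (lam : 'rV[R]_p * 'rV[R]_n -> R)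
    (rho : 'rV[R]_n -> R) (Xf : set 'rV[R]_n) (N : nat)
    (x0 : 'rV[R]_n) (th0 : 'rV[R]_p) : set (plan R n m p) :=
  [set s |
    let th := plan_param s in
    let x := plan_state s in
    let u := plan_input s in
    [/\ x 0%N = x0,
        th 0%N = th0,
        forall k : nat, (k < N)%N ->
          [/\ x k.+1 = f (x k, u k),
              Z (x k, u k) &
              lam (th k.+1, x k.+1) - lam (th k, x k) + rho (x k - xs)
                <= ell (x k, u k) - ell (xs, us)],
        forall k : nat, (k <= N)%N -> Theta (th k) &
        Xf (x N)]].

Definition plan_cost {R : realType} {n m p : nat}
    (ell : 'rV[R]_n * 'rV[R]_m -> R) (Vf : 'rV[R]_n -> R) (N : nat)
    (s : plan R n m p) : R :=
  (\sum_(k < N) ell (plan_state s k, plan_input s k)) + Vf (plan_state s N).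

Definition feasible_set {R : realType} {n m p : nat} (X : set 'rV[R]_n)
    (f : 'rV[R]_n * 'rV[R]_m -> 'rV[R]_n) (Z : set ('rV[R]_n * 'rV[R]_m))
    (ell : 'rV[R]_n * 'rV[R]_m -> R) (xs : 'rV[R]_n) (us : 'rV[R]_m)
    (Theta : set 'rV[R]_p) (lam : 'rV[R]_p * 'rV[R]_n -> R)
    (rho : 'rV[R]_n -> R) (Xf : set 'rV[R]_n) (N : nat) :
    set ('rV[R]_n * 'rV[R]_p) :=
  [set z | [/\ X z.1, Theta z.2 &
    feasible f Z ell xs us Theta lam rho Xf N z.1 z.2 !=set0]].

Definition optimal {R : realType} {n m p : nat}
    (f : 'rV[R]_n * 'rV[R]_m -> 'rV[R]_n) (Z : set ('rV[R]_n * 'rV[R]_m))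
    (ell : 'rV[R]_n * 'rV[R]_m -> R) (xs : 'rV[R]_n) (us : 'rV[R]_m)
    (Theta : set 'rV[R]_p) (lam : 'rV[R]_p * 'rV[R]_n -> R)
    (rho : 'rV[R]_n -> R) (Xf : set 'rV[R]_n) (Vf : 'rV[R]_n -> R) (N : nat)
    (x0 : 'rV[R]_n) (th0 : 'rV[R]_p) : set (plan R n m p) :=
  argmin (plan_cost ell Vf N)
         (feasible f Z ell xs us Theta lam rho Xf N x0 th0).

(* At every time, the step is made by some optimal solution if there is one.
   Solvability is not presupposed: requiring an optimal solution at every time
   would already make every problem along the closed loop feasible.  At a pair
   (x t, th t) whose problem has no optimal solution, the next pair is
   arbitrary, so feasibility along all closed loops is not weakened. *)
Definition closed_loop {R : realType} {n m p : nat}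
    (f : 'rV[R]_n * 'rV[R]_m -> 'rV[R]_n) (Z : set ('rV[R]_n * 'rV[R]_m))
    (ell : 'rV[R]_n * 'rV[R]_m -> R) (xs : 'rV[R]_n) (us : 'rV[R]_m)
    (Theta : set 'rV[R]_p) (lam : 'rV[R]_p * 'rV[R]_n -> R)
    (rho : 'rV[R]_n -> R) (Xf : set 'rV[R]_n) (Vf : 'rV[R]_n -> R) (N : nat)
    (x : nat -> 'rV[R]_n) (th : nat -> 'rV[R]_p) : Prop :=
  forall t : nat,
    let opt := optimal f Z ell xs us Theta lam rho Xf Vf N (x t) (th t) in
    opt !=set0 ->
    exists s, [/\ opt s,
                  x t.+1 = f (x t, plan_input s 0%N) &
                  th t.+1 = plan_param s 1%N].

(* Main.v *)
(** The next pair of the closed loop is constrained only where an optimal plan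
    exists, so it must first be shown that a feasible problem is solvable.  Take
    an ultrafilter finer than the sublevel sets of the cost among feasible
    plans: compactness of [Z], [Theta] and [Xf] makes every relevant component
    converge along it, continuity makes the limit plan feasible, and its cost is
    at most that of every feasible plan.  Recursive feasibility then follows by
    dropping the first step of the optimal plan and appending the terminal
    policy, with the new parameter given by (A4). *)
Require Import Defs.
From HB Require Import structures.
From mathcomp Require Import all_boot all_order all_algebra.
From mathcomp Require Import all_classical all_reals all_analysis.
Set Implicit Arguments.
Unset Strict Implicit.
Unset Printing Implicit Defensive.
Import Order.TTheory GRing.Theory Num.Theory.
Import numFieldNormedType.Exports.
Local Open Scope classical_set_scope.
Local Open Scope ring_scope.

(** Compactness gives a cluster point [l]. For a neighbourhood [B] of [l], the ultrafilter contains
    the preimage of [B] or of its complement, and the latter is excluded because it would have to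
    meet [B]. *)
Lemma ultra_compact_cvg (T : Type) (V : topologicalType) (F : set_system T)
    (FU : UltraFilter F) (A : set V) (h : T -> V) :
  compact A -> (\forall s \near F, A (h s)) ->
  exists2 l, A l & h s @[s --> F] --> l.
Proof.
move=> cA FA; have FF := ultra_proper (F := F).
have [l [Al cl]] := cA (h @ F) _ FA.
exists l => // B Bl.
have [//|FnB] := in_ultra_setVsetC (h @^-1` B) FU.
by have [y [nBy By]] := cl (~` B) B FnB Bl.
Qed.

(** Continuity relative to [A] controls [g] only at points of [A], which is where [h] eventually
    lies. This serves [f], [ell], [lam] and [Vf], each continuous on its own domain. *)
Lemma continuous_within_cvg (T : Type) (V W : topologicalType)
    (F : set_system T) {FF : Filter F} (A : set V) (g : V -> W) (h : T -> V)
    (l : V) :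
  {within A, continuous g} -> A l -> (\forall s \near F, A (h s)) ->
  h s @[s --> F] --> l -> g (h s) @[s --> F] --> g l.
Proof.
move=> /subspace_continuousP gA Al FA hl B /(gA _ Al) Bl.
have := hl _ Bl; apply: filterS2 FA => s Ahs; exact.
Qed.

Lemma cvg_eq_near (T : Type) (V : topologicalType) (F : set_system T)
    {FF : ProperFilter F} (g h : T -> V) (a b : V) :
  hausdorff_space V -> (\forall s \near F, g s = h s) ->
  g s @[s --> F] --> a -> h s @[s --> F] --> b -> a = b.
Proof.
move=> hV gh ga hb; apply: (cvg_unique hV) ga _.
by apply: cvg_trans hb; apply: near_eq_cvg; apply: filterS gh.
Qed.

Lemma cvg_le_near (R : realType) (T : Type) (F : set_system T)
    {FF : ProperFilter F} (g h : T -> R) (a b : R) :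
  (\forall s \near F, g s <= h s) ->
  g s @[s --> F] --> a -> h s @[s --> F] --> b -> a <= b.
Proof.
move=> gh ga hb; rewrite -subr_ge0.
apply: (closed_cvg (fun y : R => 0 <= y)) (cvgB hb ga); first exact: closed_ge.
by apply: filterS gh => s; rewrite subr_ge0.
Qed.

Lemma sum_cvg (R : realType) (T : Type) (F : set_system T) {FF : Filter F}
    (N : nat) (g : nat -> T -> R) (a : nat -> R) :
  (forall k, (k < N)%N -> g k s @[s --> F] --> a k) ->
  (\sum_(k < N) g k s) @[s --> F] --> \sum_(k < N) a k.
Proof.
elim: N => [|N IH] ga.
  rewrite big_ord0 (_ : (fun s => _) = cst 0); first exact: cvg_cst.
  by apply/funext => s; rewrite big_ord0.
rewrite big_ord_recr (_ : (fun s => _) =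
  (fun s => \sum_(k < N) g k s) \+ g N); last first.
  by apply/funext => s; rewrite big_ord_recr.
by apply: cvgD; [apply: IH => k kN; apply: ga; exact: ltnW | exact: ga].
Qed.

(** Costs are totally ordered, so of two sublevel sets one contains the other. Each is nonempty
    since it contains the point that defines it. This filter replaces a minimising sequence. *)
Lemma sublevel_filter (R : realType) (T : Type) (c : T -> R) (S : set T) :
  S !=set0 ->
  ProperFilter (filter_from S (fun s => [set s' | S s' /\ c s' <= c s])).
Proof.
move=> [s0 Ss0]; apply: filter_from_proper; last by move=> s Ss; exists s.
apply: filter_from_filter; first by exists s0.
move=> s1 s2 S1 S2; have [le12|/ltW le21] := leP (c s1) (c s2).
- by exists s1 => // s [Ss les]; do 2!split=> //; exact: le_trans le12.
- by exists s2 => // s [Ss les]; do 2!split=> //; exact: le_trans le21.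
Qed.

Lemma optimal_exists (R : realType) (n m p : nat)
    (X : set 'rV[R]_n) (U : set 'rV[R]_m)
    (f : 'rV[R]_n * 'rV[R]_m -> 'rV[R]_n)
    (Z : set ('rV[R]_n * 'rV[R]_m)) (ell : 'rV[R]_n * 'rV[R]_m -> R)
    (xs : 'rV[R]_n) (us : 'rV[R]_m)
    (Theta : set 'rV[R]_p) (lam : 'rV[R]_p * 'rV[R]_n -> R)
    (rho : 'rV[R]_n -> R) (Xf : set 'rV[R]_n) (Vf : 'rV[R]_n -> R)
    (N : nat) (x0 : 'rV[R]_n) (th0 : 'rV[R]_p) :
  {within X `*` U, continuous f} -> Z `<=` X `*` U -> compact Z ->
  {within Z, continuous ell} -> continuous rho -> compact Theta ->
  {within Theta `*` X, continuous lam} -> Xf `<=` X -> compact Xf ->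
  {within Xf, continuous Vf} ->
  feasible f Z ell xs us Theta lam rho Xf N x0 th0 !=set0 ->
  optimal f Z ell xs us Theta lam rho Xf Vf N x0 th0 !=set0.
Proof.
move=> f_cont ZXU Z_cpt ell_cont rho_cont Th_cpt lam_cont XfX Xf_cpt Vf_cont.
set S := feasible _ _ _ _ _ _ _ _ _ _ _ _; move=> S0.
have [F [FU subF]] :=
  ultraFilterLemma (sublevel_filter (plan_cost ell Vf N) S0).
have FF := ultra_proper (F := F).
have Fle s : S s ->
    \forall s' \near F, plan_cost ell Vf N s' <= plan_cost ell Vf N s.
  by move=> Ss; apply: subF; exists s => // s' [].
have FS : \forall s \near F, S s.
  by case: S0 => s Ss; apply: subF; exists s => // s' [].
have FZ k : (k < N)%N -> \forall s \near F, Z (plan_state s k, plan_input s k).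
  by move=> kN; apply: filterS FS => s [_ _ /(_ _ kN)[]].
have FTh k : (k <= N)%N -> \forall s \near F, Theta (plan_param s k).
  by move=> kN; apply: filterS FS => s [_ _ _ /(_ _ kN)].
have FXf : \forall s \near F, Xf (plan_state s N).
  by apply: filterS FS => s [].
(* [choice] asks for a value at every index; past the horizon the implication is void and [0] serves
   as a default. *)
have [yth ythP] : {yth : nat -> 'rV[R]_p & forall k, (k <= N)%N ->
    Theta (yth k) /\ plan_param s k @[s --> F] --> yth k}.
  apply: (@choice _ _ (fun k l => (k <= N)%N ->
    Theta l /\ plan_param s k @[s --> F] --> l)) => k.
  have [kN|_] := leqP k N; last by exists 0.
  by have [l Tl hl] := ultra_compact_cvg FU Th_cpt (FTh k kN); exists l.
have [z zP] : {z : nat -> 'rV[R]_n * 'rV[R]_m & forall k, (k < N)%N ->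
    Z (z k) /\ (plan_state s k, plan_input s k) @[s --> F] --> z k}.
  apply: (@choice _ _ (fun k l => (k < N)%N ->
    Z l /\ (plan_state s k, plan_input s k) @[s --> F] --> l)) => k.
  have [kN|_] := ltnP k N; last by exists 0.
  by have [l Zl hl] := ultra_compact_cvg FU Z_cpt (FZ k kN); exists l.
have [xN XfxN xNP] := ultra_compact_cvg FU Xf_cpt FXf.
(* Before step [N] the state converges jointly with its input, inside [Z]. The final state has no
   input, so its limit comes from [Xf]. *)
pose y k := if (k < N)%N then (z k).1 else xN.
have yN : y N = xN by rewrite /y ltnn.
have zE k : (k < N)%N -> z k = (y k, (z k).2).
  by move=> kN; rewrite /y kN; case: (z k).
have yP k : (k <= N)%N -> plan_state s k @[s --> F] --> y k.
  rewrite leq_eqVlt => /orP[/eqP ->|kN]; first by rewrite yN; exact: xNP.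
  rewrite /y kN; have [_ zk] := zP k kN.
  apply: (@cvg_comp _ _ _
    (fun s : plan R n m p => (plan_state s k, plan_input s k)) fst _ _ _ zk).
  exact: cvg_fst.
(* Since [lam] is continuous only on [Theta] times [X], the states must be placed in [X]: through
   [Z] before step [N], through [Xf] at step [N]. *)
have FX k : (k <= N)%N -> \forall s \near F, X (plan_state s k).
  rewrite leq_eqVlt => /orP[/eqP ->|kN]; last first.
    by apply: filterS (FZ k kN) => s /ZXU[].
  by apply: filterS FXf => s /XfX.
have Xy k : (k <= N)%N -> X (y k).
  rewrite leq_eqVlt => /orP[/eqP ->|kN]; first by rewrite yN; exact: XfX.
  by have [/ZXU[]] := zP k kN; rewrite /y kN.
have lamP k : (k <= N)%N ->
    lam (plan_param s k, plan_state s k) @[s --> F] --> lam (yth k, y k).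
  move=> kN; have [Tk thk] := ythP k kN.
  apply: (continuous_within_cvg lam_cont).
  - by split=> //; exact: Xy.
  - by apply: filterS2 (FTh k kN) (FX k kN) => s; split.
  - exact: (cvg_pair thk (yP k kN)).
have ellP k : (k < N)%N ->
    ell (plan_state s k, plan_input s k) @[s --> F] --> ell (y k, (z k).2).
  move=> kN; rewrite -zE//; have [Zk zk] := zP k kN.
  exact: (continuous_within_cvg ell_cont Zk (FZ k kN)).
exists (Plan yth y (fun k => (z k).2)); split.
  split=> /=.
  (* Each constraint holds throughout a set of [F], hence passes to the limit: equalities by
     uniqueness of limits, inequalities by closedness of the order. *)
  - apply: (cvg_eq_near _ _ (yP 0%N _) (cvg_cst x0)) => //.
    by apply: filterS FS => s [].
  - apply: (cvg_eq_near _ _ (ythP 0%N _).2 (cvg_cst th0)) => //.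
    by apply: filterS FS => s [].
  - move=> k kN; have [Zk zk] := zP k kN; rewrite -zE//; split=> //.
    + apply: (cvg_eq_near _ _ (yP k.+1 kN)
        (continuous_within_cvg f_cont (ZXU _ Zk) _ zk)) => //.
      * by apply: filterS FS => s [_ _ /(_ _ kN)[]].
      * by apply: filterS (FZ k kN) => s /ZXU.
    + have rhoP : rho (plan_state s k - xs) @[s --> F] --> rho (y k - xs).
        apply: (@cvg_comp _ _ _ (fun s : plan R n m p => plan_state s k - xs)
                 rho); last exact: rho_cont.
        by apply: cvgB; [exact: yP (ltnW kN) | exact: cvg_cst].
      rewrite zE//.
      apply: (cvg_le_near _ (cvgD (cvgB (lamP k.+1 kN) (lamP k (ltnW kN))) rhoP)
        (cvgB (ellP k kN) (cvg_cst (ell (xs, us))))).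
      by apply: filterS FS => s [_ _ /(_ _ kN)[]].
  - by move=> k /ythP[].
  - by rewrite yN.
(* The sublevel set of any competitor [s] belongs to [F], so the limit of the costs along [F] cannot
   exceed the cost of [s]. *)
move=> s /Fle sle; apply: (cvg_le_near sle _ (cvg_cst _)).
apply: cvgD; first exact: sum_cvg ellP.
by rewrite /= yN; exact: continuous_within_cvg Vf_cont XfxN FXf xNP.
Qed.

Lemma feasible_shift (R : realType) (n m p : nat)
    (f : 'rV[R]_n * 'rV[R]_m -> 'rV[R]_n)
    (Z : set ('rV[R]_n * 'rV[R]_m)) (ell : 'rV[R]_n * 'rV[R]_m -> R)
    (xs : 'rV[R]_n) (us : 'rV[R]_m)
    (Theta : set 'rV[R]_p) (lam : 'rV[R]_p * 'rV[R]_n -> R)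
    (rho : 'rV[R]_n -> R) (Xf : set 'rV[R]_n) (kappa : 'rV[R]_n -> 'rV[R]_m)
    (N : nat) (x0 : 'rV[R]_n) (th0 : 'rV[R]_p) (s : plan R n m p) :
  (1 <= N)%N ->
  (forall x, Xf x -> Z (x, kappa x)) ->
  (forall x, Xf x -> Xf (f (x, kappa x))) ->
  (forall x th, Xf x -> Theta th ->
     exists2 th', Theta th' &
       lam (th', f (x, kappa x)) - lam (th, x)
         <= ell (x, kappa x) - ell (xs, us) - rho (x - xs)) ->
  feasible f Z ell xs us Theta lam rho Xf N x0 th0 s ->
  feasible f Z ell xs us Theta lam rho Xf N
    (f (x0, plan_input s 0%N)) (plan_param s 1%N) !=set0.
Proof.
move=> N1 XfZ Xff XfA4 [<- _ sdyn sTh sXf].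
(* The terminal decrease is used at the last state of the plan together with its last parameter. *)
have [th' Tth' lth'] := XfA4 _ _ sXf (sTh N (leqnn N)).
pose x' := f (plan_state s N, kappa (plan_state s N)).
(* Old states and parameters [1, ..., N] fill positions [0, ..., N-1], with new values at [N].
   Inputs are one fewer, so the terminal policy already enters at [N-1]; hence the test on
   [k.+1]. *)
exists (Plan (fun k => if (k < N)%N then plan_param s k.+1 else th')
             (fun k => if (k < N)%N then plan_state s k.+1 else x')
             (fun k => if (k.+1 < N)%N then plan_input s k.+1
                       else kappa (plan_state s N))).
split=> /=.
- by rewrite N1; have [] := sdyn 0%N N1.
- by rewrite N1.
- move=> k kN; rewrite kN.
  have [k1N|] := ltnP k.+1 N; first exact: sdyn.
  (* Only the appended step remains; its storage inequality is [lth'] with the [rho] term moved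
     across. *)
  move=> Nk; have -> : k.+1 = N by apply/eqP; rewrite eqn_leq kN.
  by split=> //; [exact: XfZ | rewrite -lerBrDr].
- by move=> k kN; case: ifP => // k1N; exact: sTh.
- by rewrite ltnn; exact: Xff.
Qed.

Theorem proposition10 (R : realType) (n m p : nat)
  (X : set 'rV[R]_n) (U : set 'rV[R]_m)
  (f : 'rV[R]_n * 'rV[R]_m -> 'rV[R]_n)
  (Z : set ('rV[R]_n * 'rV[R]_m)) (ell : 'rV[R]_n * 'rV[R]_m -> R)
  (xs : 'rV[R]_n) (us : 'rV[R]_m)
  (Theta : set 'rV[R]_p) (lam : 'rV[R]_p * 'rV[R]_n -> R)
  (rho : 'rV[R]_n -> R)
  (Xf : set 'rV[R]_n) (kappa : 'rV[R]_n -> 'rV[R]_m) (Vf : 'rV[R]_n -> R)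
  (N : nat) (hN : (1 <= N)%N)
  (f_maps : forall z, (X `*` U) z -> X (f z))
  (f_cont : {within X `*` U, continuous f})
  (Z_sub : Z `<=` X `*` U)
  (Z_compact : compact Z)
  (ell_cont : {within Z, continuous ell})
  (xus_opt : argmin ell (steady_states f Z) = [set (xs, us)])
  (rho_pd : positive_definite rho)
  (A1 : compact Theta)
  (A2 : {within Theta `*` X, continuous lam})
  (A3_Xf_sub : Xf `<=` X)
  (A3_Xf_compact : compact Xf)
  (A3_xs_interior : Xf° xs)
  (A3_kappa_maps : forall x, X x -> U (kappa x))
  (A3_kappa_xs : kappa xs = us)
  (A3_Vf_cont : {within Xf, continuous Vf})
  (A3_i : forall x, Xf x -> Z (x, kappa x))
  (A3_ii : forall x, Xf x -> Xf (f (x, kappa x)))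
  (A4 : forall x th, Xf x -> Theta th ->
     exists2 th', Theta th' &
       lam (th', f (x, kappa x)) - lam (th, x)
         <= ell (x, kappa x) - ell (xs, us) - rho (x - xs)) :
  forall (x0 : 'rV[R]_n) (th0 : 'rV[R]_p),
    feasible_set X f Z ell xs us Theta lam rho Xf N (x0, th0) ->
    forall (x : nat -> 'rV[R]_n) (th : nat -> 'rV[R]_p),
      x 0%N = x0 -> th 0%N = th0 ->
      closed_loop f Z ell xs us Theta lam rho Xf Vf N x th ->
      forall t : nat,
        feasible_set X f Z ell xs us Theta lam rho Xf N (x t, th t).
Proof.
move=> x0 th0 feas0 x th x0E th0E loop; elim=> [|t [Xt _ feast]].
  by rewrite x0E th0E.
have rho_cont : continuous rho by case: rho_pd.
(* Feasibility at time [t] yields an optimal plan, which is what makes [loop] determine the next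
   pair. *)
have [s [[sfeas _] -> ->]] := loop t (optimal_exists f_cont Z_sub Z_compact
  ell_cont rho_cont A1 A2 A3_Xf_sub A3_Xf_compact A3_Vf_cont feast).
have [s0 _ sdyn sTh _] := sfeas.
split=> /=; last exact: feasible_shift hN A3_i A3_ii A4 sfeas.
(* As [N] is at least 1, the plan has a first step, whose pair lies in [Z] and so in the domain that
   [f] maps into [X]. *)
- by have [_ Z0 _] := sdyn 0%N hN; apply: f_maps; apply: Z_sub; rewrite -s0.
- exact: sTh.
Qed.
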